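(* Let $E$ be a real separated locally convex space and let $f, f_n\in\Lambda(E)$ $(n\geq 1)$. Assume that $f(x)=\sum_{n\geq 1}f_n(x)$ for every $x\in E$. If $f$ and $f_n$ (for every $n\ge 1$) are continuous on $\operatorname{int}(\operatorname{dom}f)$, then $$\partial f(x)=w^{*}\text{-}\sum_{n\geq 1}\partial f_n(x)\qquad \forall x\in\operatorname{int}(\operatorname{dom}f),$$ that is, for every $x\in\operatorname{int}(\operatorname{dom}f)$ the sequence of sets $(\partial f_n(x))_{n\geq1}$ converges normally to $\partial f(x)$ with respect to the weak$^*$ topology $w^*$ of $E^*$.
   Context: $E^*$ is the topological dual of $E$, with pairing $\langle x,x^*\rangle$. $\Lambda(E)$ is the set of proper convex functions $f:E\to(-\infty,\infty]$ (proper: not identically $\infty$); $\operatorname{dom}f=\{x: f(x)<\infty\}$. The equality $f(x)=\sum_{n\ge1}f_n(x)$ means that $\lim_{n\to\infty}\sum_{k=1}^n f_k(x)$ exists in $[-\infty,\infty]$ and equals $f(x)$. For $x\in \operatorname{dom} f$, $\partial f(x)=\{x^*\in E^*: \langle y-x,x^*\rangle\le f(y)-f(x)\ \forall y\in E\}$ is the subdifferential. Normal convergence: let $(F,\tau)$ be a real separated locally convex space and let $A, A_n$ $(n\ge1)$ be nonempty subsets of $F$. The notation $(x_n)_{n\ge1}\subset(A_n)_{n\ge1}$ means $x_n\in A_n$ for every $n\ge1$. One says that $(A_n)_{n\ge1}$ converges normally to $A$ with respect to $\tau$, written $A=\tau\text{-}\sum_{n\ge1}A_n$, if: (I) for every sequence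 $(x_n)_{n\ge1}\subset(A_n)_{n\ge1}$ the series $\sum_{n\ge1}x_n$ is $\tau$-convergent and its sum belongs to $A$; (II) for each $\tau$-neighborhood $U$ of $0$ in $F$ there is $n_0\ge1$ such that $\sum_{k\ge n}x_k\in U$ for all sequences $(x_n)_{n\ge1}\subset(A_n)_{n\ge1}$ and all $n\ge n_0$; (III) for each $x\in A$ there exists $(x_n)_{n\ge1}\subset(A_n)_{n\ge1}$ such that $x=\tau\text{-}\sum_{n\ge1}x_n$ (i.e. $x$ is the $\tau$-limit of the partial sums). *)

(* Defs.v *)
From HB Require Import structures.
From mathcomp Require Import all_boot all_order all_algebra.
From mathcomp Require Import all_classical all_reals all_analysis.
From mathcomp Require Import ring.

Set Implicit Arguments.
Unset Strict Implicit.
Unset Printing Implicit Defensive.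

Import Order.TTheory GRing.Theory Num.Theory.
Import numFieldNormedType.Exports.

Local Open Scope classical_set_scope.
Local Open Scope ring_scope.

Section topological_dual.
Context {R : realType} (E : tvsType R).

Definition dual_pred : pred (E -> R^o) :=
  [pred g : E -> R^o | `[< linear g /\ continuous g >]].

Record dual := Dual { dual_fun :> E -> R^o ; _ : dual_fun \in dual_pred }.

HB.instance Definition _ := [isSub for dual_fun].
HB.instance Definition _ := [Choice of dual by <:].

Lemma dual_predP (g : E -> R^o) :
  reflect (linear g /\ continuous g) (g \in dual_pred).
Proof. exact: asboolP. Qed.

Lemma dual_linear (x' : dual) : linear (x' : E -> R^o).
Proof. by case: x' => g /= /dual_predP[]. Qed.

Lemma dual_continuous (x' : dual) : continuous (x' : E -> R^o).
Proof. by case: x' => g /= /dual_predP[]. Qed.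

HB.instance Definition _ (x' : dual) :=
  GRing.isLinear.Build R E R^o _ (x' : E -> R^o) (@dual_linear x').

Lemma dual_submod_closed : submod_closed dual_pred.
Proof.
split.
  apply/dual_predP; split; last by move=> x; exact: cvg_cst.
  by move=> a x y /=; rewrite scaler0 addr0.
move=> a g h /dual_predP[gl gc] /dual_predP[hl hc]; apply/dual_predP; split.
  move=> b x y; rewrite !fctE gl hl !scalerDr !scalerA (mulrC a b).
  by rewrite -!addrA; congr (_ + _); rewrite addrCA.
by move=> x; apply: cvgD; [apply: cvgZr; exact: gc|exact: hc].
Qed.

HB.instance Definition _ :=
  GRing.isSubmodClosed.Build R (E -> R^o) dual_pred dual_submod_closed.
HB.instance Definition _ := [SubChoice_isSubLmodule of dual by <:].

(* The weak* topology: the topology of pointwise convergence on E. *)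
HB.instance Definition _ := Topological.copy dual
  (initial_topology (fun x' : dual => (x' : E -> R^o) : {ptws E -> R^o})).

Lemma dual_cvgP (F : set_system dual) (x' : dual) : Filter F ->
  F --> x' <-> forall x : E, (fun y' : dual => y' x) @ F --> x' x.
Proof.
move=> FF.
pose i := fun y' : dual => (y' : E -> R^o) : {ptws E -> R^o}.
rewrite -(@pointwise_cvgP E R^o (i @ F) (x' : E -> R^o)).
split=> [Fx'|iFx'].
  exact: cvg_comp Fx' (@initial_continuous _ _ i x').
move=> A /= [B [[C oC <-] /= Cx'] CA].
apply: (@filterS _ F FF _ _ CA).
by apply: (iFx' C); exact: open_nbhs_nbhs.
Qed.

Lemma dual_eval_continuous (x : E) : continuous (fun x' : dual => (x' x : R^o)).
Proof.
move=> x'; have [h _] := dual_cvgP x' (nbhs_filter x').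
by apply: h => A.
Qed.

Lemma dual_add_continuous : continuous (fun z : dual * dual => z.1 + z.2).
Proof.
move=> [x' y']; apply/dual_cvgP => x.
have h1 : (fun z : dual * dual => (z.1 x : R^o)) @ (x', y') --> (x' x : R^o).
  exact: (@cvg_comp _ _ _ fst (fun u : dual => (u x : R^o)) _ _ _ cvg_fst
    (@dual_eval_continuous x x')).
have h2 : (fun z : dual * dual => (z.2 x : R^o)) @ (x', y') --> (y' x : R^o).
  exact: (@cvg_comp _ _ _ snd (fun u : dual => (u x : R^o)) _ _ _ cvg_snd
    (@dual_eval_continuous x y')).
exact: cvgD h1 h2.
Qed.

Lemma dual_scale_continuous : continuous (fun z : R^o * dual => z.1 *: z.2).
Proof.
move=> [a x']; apply/dual_cvgP => x.
have h1 : (fun z : R^o * dual => (z.1 : R^o)) @ (a, x') --> (a : R^o).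
  exact: cvg_fst.
have h2 : (fun z : R^o * dual => (z.2 x : R^o)) @ (a, x') --> (x' x : R^o).
  exact: (@cvg_comp _ _ _ snd (fun u : dual => (u x : R^o)) _ _ _ cvg_snd
    (@dual_eval_continuous x x')).
exact: cvgZ h1 h2.
Qed.

Let pball (x' : dual) (p : seq E * R) : set dual :=
  [set y' : dual | forall x, x \in p.1 -> `|x' x - y' x| < p.2].

Let pballF (x' : dual) : set_system dual :=
  filter_from [set p | 0 < p.2] (pball x').

Let pballF_filter (x' : dual) : Filter (pballF x').
Proof.
apply: filter_from_filter; first by exists ([::], 1) => /=.
move=> [s e] [t d] /= e0 d0; exists (s ++ t, Num.min e d) => /=.
  by rewrite lt_min e0.
by move=> y' h; split=> x /= xs; have := h x;
   rewrite mem_cat xs ?orbT lt_min => /(_ isT) /andP[].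
Qed.

Let nbhs_pball (x' : dual) : nbhs x' `<=` pballF x'.
Proof.
have FF := pballF_filter x'.
suff : pballF x' --> x' by [].
apply/dual_cvgP => x; apply/cvgrPdist_lt => e e0.
by exists ([:: x], e) => //= y' /(_ x); rewrite inE eqxx; exact.
Qed.

Let pball_open (x' : dual) p : open (pball x' p).
Proof.
case: p => s e; rewrite openE => y' /=; elim: s => [_|x s IHs h].
  by apply: filterS filterT => z' _ x.
have sy' : pball x' (s, e) y' by move=> z zs; apply: h; rewrite inE zs orbT.
have xy' : `|x' x - y' x| < e by apply: h; rewrite mem_head.
have cy := @dual_eval_continuous x y'.
have cxy : (fun z' : dual => `|x' x - z' x|) @ y' --> `|x' x - y' x|.
  exact: cvg_norm (cvgB (cvg_cst (x' x : R^o)) cy).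
have {}cxy : \forall z' \near y', `|x' x - (z' : dual) x| < e.
  exact: (cvgr_lt _ cxy).
apply: filterS2 cxy (IHs sy') => z' h1 h2 z.
by rewrite inE => /orP[/eqP->//|/h2].
Qed.

Let pball_convex (x' : dual) p : convex_set (pball x' p).
Proof.
apply/convex_setW => y' z' /[!inE] /= hy hz l l0 l1; rewrite inE => x xp.
have {hy} := hy x xp; have {hz} := hz x xp.
set e := p.2; set a := y' x; set b := z' x => bE aE.
have -> : (conv l (y' : convex_lmodType dual) (z' : convex_lmodType dual) :
  dual) x = l%:num * a + (1 - l%:num) * b by [].
have -> : x' x - (l%:num * a + (1 - l%:num) * b) =
   l%:num * (x' x - a) + (1 - l%:num) * (x' x - b).
  by ring.
have l0' : 0 <= 1 - l%:num :> R by rewrite subr_ge0 ltW.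
rewrite (le_lt_trans (ler_normD _ _))// !normrM (gtr0_norm l0) (ger0_norm l0').
have -> : e = l%:num * e + (1 - l%:num) * e by ring.
by rewrite ltr_leD ?ltr_pM2l ?ler_wpM2l// ltW.
Qed.

Lemma dual_locally_convex : exists2 B : set_system dual,
  (forall b, b \in B -> convex_set b) & basis B.
Proof.
exists [set A | open A /\ convex_set A].
  by move=> A /[!inE] -[].
split; first by move=> A [].
move=> x' A /nbhs_pball[p p0 pA].
exists (pball x' p) => //; split; first by split.
by move=> x _; rewrite subrr normr0.
Qed.

(* [PreTopologicalLmod_isTvs] only contributes the uniform structure. *)
HB.instance Definition _ := PreTopologicalLmod_isTvs.Build R dual
  dual_add_continuous dual_scale_continuous dual_locally_convex.
HB.instance Definition _ :=
  PreTopologicalNmodule_isTopologicalNmodule.Build dual dual_add_continuous.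
HB.instance Definition _ :=
  TopologicalNmodule_isTopologicalLmodule.Build R dual dual_scale_continuous.
HB.instance Definition _ := Uniform_isTvs.Build R dual dual_locally_convex.

Lemma dual_hausdorff : hausdorff_space dual.
Proof.
rewrite open_hausdorff => x' y' x'y'.
have [x xy] : exists x, x' x != y' x.
  apply: contrapT => h; move/eqP: x'y'; apply; apply: val_inj; apply/funext => x.
  by apply: contrapT => /eqP xy; apply: h; exists x.
have := @Rhausdorff R; rewrite open_hausdorff => /(_ _ _ xy)[[U V] /= [xU yV]].
move=> [oU oV UV].
have evc := @dual_eval_continuous x.
exists ((fun z' : dual => z' x) @^-1` U, (fun z' : dual => z' x) @^-1` V) => /=.
  by rewrite !inE in xU yV *.
split; [exact: open_comp|exact: open_comp|].
by rewrite -preimage_setI (eqP UV) preimage_set0.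
Qed.

End topological_dual.

Section convex_analysis.
Context {R : realType} {E : tvsType R}.
Implicit Types f : E -> \bar R.

Definition edom f : set E := [set x | (f x < +oo)%E].

Definition convex_efun f : Prop := forall (x y : E) (t : R), 0 <= t <= 1 ->
  (f (t *: x + (1 - t) *: y)%R <= t%:E * f x + (1 - t)%:E * f y)%E.

Definition proper_convex f : Prop :=
  [/\ forall x, f x != -oo%E, exists x, f x != +oo%E & convex_efun f].

(* The condition [edom f x] makes this empty at the points outside the domain. *)
Definition subdifferential f (x : E) : set (dual E) :=
  [set x' : dual E | edom f x /\ forall y : E, ((x' (y - x)%R : R)%:E <= f y - f x)%E].

End convex_analysis.

(* The sequences start at index 0, so [A_ n] stands for the (n+1)-st set, and
   the sum of the terms of index >= n is the limit of [\sum_(n <= k < m)] as m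
   tends to infinity. *)
Definition normally_cvg {R : realType} {F : tvsType R}
    (A_ : nat -> set F) (A : set F) : Prop :=
  [/\ (forall n, A_ n !=set0) /\ A !=set0,
      forall x_ : nat -> F, (forall n, A_ n (x_ n)) ->
        exists2 s, A s & series x_ @ \oo --> s,
      forall U : set F, nbhs 0 U ->
        exists n0 : nat, forall x_ : nat -> F, (forall n, A_ n (x_ n)) ->
          forall n, (n0 <= n)%N ->
            exists2 s, U s & (\sum_(n <= k < m) x_ k) @[m --> \oo] --> s
    & forall x : F, A x ->
        exists2 x_ : nat -> F, (forall n, A_ n (x_ n)) & series x_ @ \oo --> x].

(* Main.v *)
Require Import Defs.
From HB Require Import structures.
From mathcomp Require Import all_boot all_order all_algebra.
From mathcomp Require Import all_classical all_reals all_analysis.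
From mathcomp Require Import ring lra.

Import Order.TTheory GRing.Theory Num.Theory.
Import numFieldNormedType.Exports.

Local Open Scope classical_set_scope.
Local Open Scope ring_scope.

(* Fix x in the interior of dom f; there every f_n is finite, and we work with
   the increments h_n(u) = f_n(x + u) - f_n(x), whose sum is H(u) = f(x + u) - f(x).
   If x_n is a subgradient of f_n at x, then u and - u together enclose the terms:
   0 <= h_n(u) - x_n(u) <= h_n(u) + h_n(- u), and the right-hand side is summable;
   this gives the convergence of the series of the x_n and, uniformly in the
   choice of the x_n, the smallness of its tails.
   Conversely let y be a subgradient of f at x. A sandwich theorem for two convex
   functions, obtained from a maximal convex cone containing an epigraph, splits a
   linear y <= h_n + g into a linear x_n <= h_n and a remainder y - x_n <= g.
   Peeling off h_0, h_1, ... in this way leaves remainders dominated by the tails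
   of H, which tend to 0 pointwise on a neighbourhood of 0. *)

(** * Algebraic Hahn-Banach theory: maximal convex cones and the sandwich theorem *)

Section sandwich.
Context {R : realType} {V : lmodType R}.
Implicit Types (K : set (V * R^o)) (D : set V) (h g : V -> R).

(** Modelled on the epigraph of a real sublinear functional, without upward closure. The last two
    clauses make the infimum of every vertical slice finite: points over [u] and [- u] add up to a
    point over 0. *)
Definition epi_cone K : Prop :=
  [/\ forall p q, K p -> K q -> K (p + q),
      forall (t : R) p, 0 < t -> K p -> K (t *: p),
      forall u, exists r, K (u, r)
    & forall r, K (0, r) -> 0 <= r].

Lemma epi_cone_maximal K0 : epi_cone K0 ->
  exists K, [/\ epi_cone K, K0 `<=` K &
    forall K', epi_cone K' -> K `<=` K' -> K' `<=` K].
Proof.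
move=> c0.
pose P K := K = set0 \/ (epi_cone K /\ K0 `<=` K).
have [|K [[K_0|[cK K0K]] Kmax]] := @Zorn_bigcup _ P.
- move=> F FP Ftot.
  have [e|/set0P[p0 [X0 FX0 X0p0]]] := eqVneq (\bigcup_(X in F) X) set0.
    by left.
  have good X p : F X -> X p -> epi_cone X /\ K0 `<=` X.
    by move=> /FP[->//|].
  right; split; last first.
    by move=> q K0q; exists X0 => //; have [_] := good _ _ FX0 X0p0; exact.
  have [[_ _ tot0 _] K0X0] := good _ _ FX0 X0p0.
  split.
  + move=> p q [X FX Xp] [Y FY Yq].
    have [[addX _ _ _] _] := good _ _ FX Xp.
    have [[addY _ _ _] _] := good _ _ FY Yq.
    by case: (Ftot _ _ FX FY) => S; [exists Y|exists X] => //;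
      [apply: addY => //; exact: S|apply: addX => //; exact: S].
  + move=> t p t0 [X FX Xp]; exists X => //.
    by have [[_ + _ _] _] := good _ _ FX Xp; exact.
  + by move=> u; have [r ur] := tot0 u; exists r, X0.
  + by move=> r [X FX Xr]; have [[_ _ _ +] _] := good _ _ FX Xr; exact.
- exfalso; apply: (Kmax K0); last by right; split.
  have [_ _ /(_ 0)[r r0] _] := c0.
  by rewrite K_0; split=> // /(_ _ r0).
- exists K; split => // K' cK' KK'; apply: contrapT => K'K.
  by apply: (Kmax K') => //; right; split => //; exact: subset_trans KK'.
Qed.

(** The infimum [L] of the slices of a maximal cone is sublinear, and maximality forces
    [L (- u) <= - L u]; a sublinear functional that is odd is linear. *)
Lemma epi_cone_linear K0 : epi_cone K0 ->
  exists L : {linear V -> R^o}, forall u r, K0 (u, r) -> L u <= r.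
Proof.
move=> /epi_cone_maximal[K [[addK scaleK totK nnegK] K0K Kmax]].
pose S u := [set r : R | K (u, r)].
pose L u : R^o := inf (S u).
have S0 u : S u !=set0 by have [r] := totK u; exists r.
have lbS u : has_lbound (S u).
  have [s Ks] := totK (- u); exists (- s) => r Kr.
  have : K (- u + u, s + r) by exact: (addK (- u, s) (u, r)).
  by rewrite addNr => /nnegK; lra.
have Lle u r : K (u, r) -> L u <= r by move=> ?; exact: ge_inf.
have Lge u a : (forall r, K (u, r) -> a <= r) -> a <= L u.
  by move=> h; exact: lb_le_inf.
(* Adjoining the ray spanned by [(- u, - L u)] keeps the cone proper. *)
have LN u : L (- u) <= - L u.
  apply/ler_addgt0Pr => e e0.
  (* The cone need not contain the origin; [(0, d)] with small [d] replaces it, at the cost of an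
     error [e]. *)
  have [d Kd de] : exists2 d, K (0, d) & d <= e.
    have [r Kr] := totK 0; have r0 := nnegK _ Kr.
    exists ((e / (r + 1)) *: r).
      rewrite -[X in (X, _)](scaler0 _ (e / (r + 1))).
      by apply: scaleK Kr; rewrite divr_gt0; lra.
    by rewrite -[_ *: r]/(_ * r) mulrAC ler_pdivrMr; nra.
  suff /Lle/le_trans-> : K (- u, d - L u) by rewrite // addrC lerD2l.
  pose K' := [set p | exists q t, [/\ K q, 0 <= t & p = q - t *: (u, L u)]].
  apply: (Kmax K').
  - split.
    + move=> _ _ [q [t [Kq t0 ->]]] [q' [t' [Kq' t'0 ->]]].
      exists (q + q'), (t + t'); split; [exact: addK|exact: addr_ge0|].
      by rewrite scalerDl opprD addrACA.
    + move=> s _ s0 [q [t [Kq t0 ->]]]; exists (s *: q), (s * t).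
      by split; [exact: scaleK|rewrite mulr_ge0// ltW|rewrite scalerBr scalerA].
    + move=> v; have [r Kr] := totK v; exists r, (v, r), 0.
      by rewrite scale0r subr0.
    (* A point of [K'] over 0 has [v = t u] and [r = s - t L u]. For [t > 0], dividing by [t] puts
       [(u, s / t)] in [K], so [L u <= s / t]. *)
    + move=> r [[v s] [t [Ks t0 [] /eqP]]].
      rewrite eq_sym subr_eq0 => /eqP vE rE.
      move: t0; rewrite le_eqVlt => /predU1P[t0|t0].
        by move: Ks; rewrite rE vE -t0 !scale0r subr0; exact: nnegK.
      have : K (t^-1 *: v, t^-1 * s).
        by apply: (scaleK _ (v, s)) => //; rewrite invr_gt0.
      rewrite vE scalerA mulVf ?gt_eqF// scale1r => /Lle.
      rewrite rE subr_ge0 -[_ *: L u]/(t * L u).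
      by rewrite ler_pdivlMl.
  - by move=> p Kp; exists p, 0; rewrite scale0r subr0.
  - exists (0, d), 1; split => //.
    by rewrite scale1r; congr (_, _); rewrite /= sub0r.
have addL u v : L (u + v) <= L u + L v.
  rewrite -lerBlDr; apply: (Lge) => r Kr; rewrite lerBlDl -lerBlDr.
  apply: (Lge) => s Ks; rewrite lerBlDl; apply: (Lle).
  exact: (addK (u, r) (v, s)).
have LE u : L (- u) = - L u.
  have := addL u (- u); rewrite subrr.
  have : 0 <= L 0 by apply: (Lge) => r; exact: nnegK.
  by have := LN u; lra.
have scaleL t u : 0 < t -> L (t *: u) <= t * L u.
  move=> t0; rewrite -ler_pdivrMl//; apply: (Lge) => r Kr.
  by rewrite ler_pdivrMl//; apply: (Lle); exact: (scaleK t (u, r)).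
have scaleLE t u : 0 < t -> L (t *: u) = t * L u.
  move=> t0; have := scaleL _ u t0; have := scaleL _ (- u) t0.
  by rewrite scalerN !LE; lra.
have L0 : L 0 = 0 by have := LE 0; rewrite oppr0; lra.
have linL : linear L.
  move=> t u v.
  have -> : L (t *: u + v) = L (t *: u) + L v.
    have := addL (t *: u) v; have := addL (- (t *: u)) (- v).
    by rewrite -opprD !LE; lra.
  congr (_ + _); have [t0|t0|->] := ltrgt0P t.
  - exact: scaleLE.
  - by rewrite -{1}[t]opprK scaleNr LE scaleLE ?oppr_gt0// mulNr opprK.
  - by rewrite !scale0r.
pose lL := GRing.isLinear.Build R V R^o _ L linL.
pose L' : {linear V -> R^o} := HB.pack L lL.
by exists L' => u r Kr; apply: (Lle); exact: K0K.
Qed.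

Definition convex_on D h : Prop := forall u v (s t : R), D u -> D v ->
  0 <= s -> 0 <= t -> s + t = 1 ->
  D (s *: u + t *: v) /\ h (s *: u + t *: v) <= s * h u + t * h v.

(** Apply [epi_cone_linear] to the cone generated by the points [(v - w, h v + g w - y w)] and those
    above them. Absorption by [D] fills every slice; over 0 one has [v = w], where the hypothesis
    gives nonnegativity. The two bounds on [L] come from [w = 0] and from [v = 0]. *)
Lemma sandwich D h Dg g (y : {linear V -> R^o}) :
  convex_on D h -> D 0 -> h 0 = 0 -> (forall u, exists2 t : R, 0 < t & D (t *: u)) ->
  convex_on Dg g -> Dg 0 -> g 0 = 0 ->
  (forall u, D u -> Dg u -> y u <= h u + g u) ->
  exists L : {linear V -> R^o},
    (forall u, D u -> L u <= h u) /\ (forall u, Dg u -> y u - L u <= g u).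
Proof.
move=> ch D0 h0 absD cg Dg0 g0 yhg.
pose K := [set p : V * R^o | exists (t : R) v w, [/\ 0 < t, D v, Dg w,
  p.1 = t *: (v - w) & t * (h v + g w - y w) <= p.2]].
have [|L LK] := @epi_cone_linear K.
  split.
  - move=> [u r] [u' r'] [t [v [w [t0 Dv Dw /= -> rE]]]].
    move=> [t' [v' [w' [t'0 Dv' Dw' /= -> rE']]]].
    have T0 : 0 < t + t' by exact: addr_gt0.
    (* With these normalised weights, the sum of two generators scaled by [t] and [t'] lies above a
       generator scaled by [t + t']. *)
    pose s := t / (t + t'); pose s' := t' / (t + t').
    have ss : s + s' = 1 by rewrite /s /s' -mulrDl divff ?gt_eqF.
    have s0 : 0 <= s by rewrite divr_ge0// ltW.
    have s'0 : 0 <= s' by rewrite divr_ge0// ltW.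
    have tE : (t + t') * s = t by rewrite /s mulrC divfK ?gt_eqF.
    have tE' : (t + t') * s' = t' by rewrite /s' mulrC divfK ?gt_eqF.
    clearbody s s'.
    have [Dvv hvv] := ch _ _ _ _ Dv Dv' s0 s'0 ss.
    have [Dww gww] := cg _ _ _ _ Dw Dw' s0 s'0 ss.
    exists (t + t'), (s *: v + s' *: v'), (s *: w + s' *: w'); split=> //=.
      rewrite opprD addrACA -!scalerBr [RHS]scalerDr !scalerA.
      by rewrite tE tE'.
    rewrite linearD !linearZ/=.
    apply: (@le_trans _ _ (t * (h v + g w - y w) + t' * (h v' + g w' - y w'))).
      rewrite -[in leRHS]tE -[X in _ + X * _]tE' -!mulrA -mulrDr.
      rewrite ler_pM2l// -[s *: y w]/(s * y w) -[s' *: y w']/(s' * y w'); lra.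
    exact: lerD.
  - move=> s [u r] s0 [t [v [w [t0 Dv Dw /= -> rE]]]].
    exists (s * t), v, w; split=> //=; first exact: mulr_gt0.
      by rewrite scalerA.
    by rewrite -mulrA -[leRHS]/(_ * _) ler_pM2l.
  - move=> u; have [t t0 Dtu] := absD u.
    exists (t^-1 * (h (t *: u) + g 0 - y (0 : V))), t^-1, (t *: u), 0.
    split=> //=; first by rewrite invr_gt0.
    by rewrite subr0 scalerA mulVf ?gt_eqF// scale1r.
  - move=> r [t [v [w [t0 Dv Dw /= /esym/eqP]]]].
    rewrite scaler_eq0 gt_eqF//= subr_eq0 => /eqP vw; apply: le_trans.
    by subst w; rewrite mulr_ge0 ?(ltW t0)// subr_ge0; exact: yhg.
exists L; split=> u Du.
  apply: LK; exists 1, u, 0; split=> //=; first by rewrite subr0 scale1r.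
  by rewrite g0 linear0 addr0 subr0 mul1r.
have : L (- u) <= g u - y u.
  apply: LK; exists 1, 0, u; split=> //=; first by rewrite sub0r scale1r.
  by rewrite h0 add0r mul1r.
by rewrite linearN; lra.
Qed.

End sandwich.

(** * The weak* dual and neighbourhoods of 0 *)

Section dual_space.
Context {R : realType} {E : tvsType R}.

Lemma dual_sumE (x_ : nat -> dual E) m n u :
  (\sum_(m <= k < n) x_ k) u = \sum_(m <= k < n) (x_ k u : R).
Proof. by elim/big_rec2: _ => // i a b _ <-. Qed.

Lemma dual_seriesE (x_ : nat -> dual E) n u :
  series x_ n u = series (fun k => x_ k u : R) n.
Proof. exact: dual_sumE. Qed.

Lemma dual_cvgnP (z_ : nat -> dual E) (z : dual E) :
  z_ @ \oo --> z <-> forall u, (fun n => z_ n u : R^o) @ \oo --> (z u : R^o).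
Proof. exact: dual_cvgP. Qed.

(** The bound at [u] and at [- u] makes [L] small in absolute value near 0; translation carries
    continuity to every point. *)
Lemma dual_of_le_continuous (L : {linear E -> R^o}) (g : E -> R) :
  {for 0, continuous g} -> g 0 = 0 -> (\forall u \near 0, L u <= g u) ->
  exists x' : dual E, forall u, x' u = L u.
Proof.
move=> cg g0 Lg.
have L0 e : 0 < e -> \forall u \near 0, `|L u| < e.
  move=> e0.
  have Le : \forall u \near 0, L u < e.
    have ge : \forall u \near 0, g u < e by apply: (cvgr_lt _ cg); rewrite g0.
    by apply: filterS2 Lg ge => u; exact: le_lt_trans.
  have LeN : \forall u \near 0, L (- u) < e.
    by have := nbhs0N Le; apply: filterS => _ [v Lv <-]; rewrite opprK.
  apply: filterS2 Le LeN => u; rewrite linearN/= => h1 h2.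
  by rewrite ltr_norml; lra.
have cL : continuous L.
  move=> u; apply/cvgrPdist_lt => e /L0 /(nbhsT u); apply: filterS => _ [v Lv <-].
  by rewrite linearD opprD addNKr normrN.
have Ld : (L : E -> R^o) \in @dual_pred R E.
  by apply/dual_predP; split => //; exact: linearP.
by exists (Dual Ld).
Qed.

(** One [t] serves both signs, since linear minorants are estimated at [u] and [- u] together;
    [t <= 1] lets it act as a convex weight. *)
Lemma nbhs0_absorbing (D : set E) u : nbhs 0 D ->
  exists2 t : R, 0 < t <= 1 & D (t *: u) /\ D (- (t *: u)).
Proof.
move=> D0.
have cs (v : E) : (fun t : R^o => t *: v) @ (0 : R^o) --> (0 : E).
  rewrite -[X in _ --> X](scale0r v).
  have tv : (fun t : R^o => (t, v)) @ (0 : R^o) --> ((0, v) : R^o * E).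
    exact: (cvg_pair (@cvg_id _ (nbhs (0 : R^o))) (cvg_cst v)).
  exact: cvg_comp tv (@scale_continuous R E (0, v)).
have [e /= e0 eD] : nbhs (0 : R^o) [set t | D (t *: u) /\ D (t *: - u)].
  by apply: filterI; exact: cs.
exists (Num.min (e / 2) 1); first by rewrite lt_min ge_min lexx orbT andbT; lra.
have := eD (Num.min (e / 2) 1); rewrite /= scalerN; apply.
rewrite sub0r normrN gtr0_norm; first by rewrite gt_min; lra.
by rewrite lt_min; lra.
Qed.

End dual_space.

Lemma cvg_series_tail {R : realType} (a : R^nat) n (l : R) :
  series a @ \oo --> l -> (\sum_(n <= k < m) a k) @[m --> \oo] --> l - series a n.
Proof.
move=> al; apply: cvg_trans (cvgB al (cvg_cst (series a n))).
apply: near_eq_cvg; near=> m.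
by rewrite -sub_series_geq//; near: m; exact: nbhs_infty_ge.
Unshelve. all: by end_near. Qed.

(** * Series of linear minorants of the terms of a convergent series *)

Section subgradient_series.
Context {R : realType} {E : tvsType R}.
Context (D : set E) (h : nat -> E -> R) (H : E -> R).
Context (D0 : nbhs 0 D) (hH : forall u, D u -> series (h ^~ u) @ \oo --> H u).

(** On [D] this is the tail of the series from index [n] on; the difference form avoids limits. *)
Let gap n u := H u - series (h ^~ u) n.

(** For [t u] and [- t u] in [D], the value [y (t u)] lies between [- gap n (- t u)] and
    [gap n (t u)], which tend to 0 independently of [y]. *)
Lemma gap_small (U : set (dual E)) : nbhs 0 U -> exists n0, forall n (y : dual E),
  (n0 <= n)%N -> (forall v, D v -> y v <= gap n v) -> U y.
Proof.
(* Uniformity in [y] is expressed as convergence to 0 of the filter generated by the sets [T n0], so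
   that [dual_cvgP] reduces it to one [u] at a time. *)
pose T n0 := [set y : dual E |
  exists2 n, (n0 <= n)%N & forall v, D v -> y v <= gap n v].
have FF : Filter (filter_from [set: nat] T).
  apply: filter_from_filter; first by exists 0%N.
  move=> i j _ _; exists (maxn i j) => // y [n].
  by rewrite geq_max => /andP[ni nj] yn; split; exists n.
suff F0 : filter_from [set: nat] T --> (0 : dual E).
  by move=> /F0[n0 _ TU]; exists n0 => n y n0n yn; apply: TU; exists n.
apply/dual_cvgP => u.
have [t /andP[t0 _] [Dtu DNtu]] := nbhs0_absorbing _ u D0.
have gap0 v : D v -> gap ^~ v @ \oo --> 0.
  by move=> /hH hHv; rewrite -(subrr (H v)); apply: cvgB => //; exact: cvg_cst.
apply/cvgr0Pnorm_lt => e e0.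
have te : 0 < t * e by exact: mulr_gt0.
have [N _ gapN] : \forall n \near \oo,
    `|gap n (t *: u)| < t * e /\ `|gap n (- (t *: u))| < t * e.
  have gapN v : D v -> \forall n \near \oo, `|gap n v| < t * e.
    by move=> /gap0 gapv; move/cvgr0Pnorm_lt : gapv; exact.
  by apply: filterI; exact: gapN.
exists N => //= y [n Nn yn]; have [h1 h2] := gapN n Nn.
rewrite -(ltr_pM2l t0) -[X in X * _](gtr0_norm t0) -normrM.
have -> : t * y u = y (t *: u) by rewrite linearZ.
have := yn _ Dtu; have := yn _ DNtu; rewrite linearN/=.
move: h1 h2; rewrite !ltr_norml => /andP[_ h1] /andP[_ h2] h3 h4.
lra.
Qed.

Definition minorants (x_ : nat -> dual E) :=
  forall n u, D u -> x_ n u <= h n u.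

Lemma minorants_tail_le {x_ : nat -> dual E} n u l : minorants x_ -> D u ->
  (\sum_(n <= k < m) (x_ k u : R)) @[m --> \oo] --> (l : R) -> l <= gap n u.
Proof.
move=> xh Du xl; have hl := cvg_series_tail _ n _ (hH _ Du).
apply: (ler_cvg_to xl hl); near=> m.
by apply: ler_sum => k _; exact: xh.
Unshelve. all: by end_near. Qed.

(** Comparison test for the slack [c] at [t u], bounded through the minorant inequality at [- t u];
    the terms [x_ k u] are then recovered by rescaling. *)
Lemma minorants_cvgn (x_ : nat -> dual E) u : minorants x_ ->
  cvgn (series (fun k => x_ k u : R)).
Proof.
move=> xh; have [t /andP[t0 _] [Dtu DNtu]] := nbhs0_absorbing _ u D0.
pose c k : R := h k (t *: u) - x_ k (t *: u).
have ch : cvgn (series (h ^~ (t *: u))) by apply: cvgP; exact: hH.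
have chN : cvgn (series (h ^~ (- (t *: u)))) by apply: cvgP; exact: hH.
have cc : cvgn (series c).
  have c0 k : 0 <= c k by rewrite subr_ge0; exact: xh.
  have cd k : c k <= h k (t *: u) + h k (- (t *: u)).
    by have := xh k _ DNtu; rewrite linearN /c/=; lra.
  apply: (series_le_cvg c0 _ cd) => [k|]; first exact: le_trans (cd k).
  exact: is_cvg_seriesD ch chN.
have -> : (fun k => x_ k u : R) = t^-1 *: (h ^~ (t *: u) - c).
  apply/funext => k; rewrite !fctE /c opprB addrC subrK linearZ/= scalerA.
  by rewrite mulVf ?gt_eqF// scale1r.
by apply: is_cvg_seriesZ; exact: is_cvg_seriesB.
Qed.

(** The pointwise sum is linear and dominated by [H] on [D]; continuity of [H] at 0 then puts it in
    the dual. *)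
Lemma minorants_series (x_ : nat -> dual E) : H 0 = 0 -> {for 0, continuous H} ->
  minorants x_ ->
  exists2 s : dual E, forall u, D u -> s u <= H u & series x_ @ \oo --> s.
Proof.
move=> H0 cH xh.
pose s (u : E) : R^o := limn (series (fun k => x_ k u : R)).
have xs u : series (fun k => x_ k u : R) @ \oo --> s u.
  exact: minorants_cvgn.
have sH u : D u -> s u <= H u.
  move=> Du; have := minorants_tail_le 0 _ _ xh Du (xs u).
  by rewrite /gap /series/= big_geq// subr0.
have ls : linear s.
  move=> a u v; apply: (@cvg_lim R^o) => //.
  have -> : series (fun k => x_ k (a *: u + v) : R) =
      fun n => a *: (series (fun k => x_ k u : R) n : R^o) +
               series (fun k => x_ k v : R) n.
    by apply/funext => n; rewrite -!dual_seriesE linearP.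
  by apply: cvgD; [apply: cvgZl_tmp; exact: xs|exact: xs].
pose lS := GRing.isLinear.Build R E R^o _ s ls.
pose s' : {linear E -> R^o} := HB.pack s lS.
have [|s'' s''E] := dual_of_le_continuous s' _ cH H0; first exact: filterS D0.
exists s'' => [u Du|]; first by rewrite s''E; exact: sH.
apply/dual_cvgnP => u; rewrite s''E.
under eq_fun do rewrite dual_seriesE.
exact: xs.
Unshelve. all: by end_near. Qed.

Lemma dual_cvg_series_tail (x_ : nat -> dual E) n (s : dual E) :
  series x_ @ \oo --> s ->
  (\sum_(n <= k < m) x_ k) @[m --> \oo] --> s - series x_ n.
Proof.
move=> /dual_cvgnP xs; apply/dual_cvgnP => u.
under eq_fun do rewrite dual_sumE.
have xu : series (fun k => x_ k u : R) @ \oo --> (s u : R).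
  by have := xs u; under eq_fun do rewrite dual_seriesE.
by have := cvg_series_tail _ n _ xu; rewrite -dual_seriesE; exact.
Qed.

(** Every tail from [n] on is dominated by [gap n] on [D], whatever the minorants, so [gap_small]
    supplies a uniform [n0]. *)
Lemma minorants_tail_small (U : set (dual E)) : H 0 = 0 ->
  {for 0, continuous H} -> nbhs 0 U ->
  exists n0 : nat, forall x_, minorants x_ -> forall n, (n0 <= n)%N ->
    exists2 s, U s & (\sum_(n <= k < m) x_ k) @[m --> \oo] --> s.
Proof.
move=> H0 cH /gap_small[n0 Un0]; exists n0 => x_ xh n n0n.
have [s _ /dual_cvg_series_tail xs] := minorants_series _ H0 cH xh.
exists (s - series x_ n) => //; apply: (Un0 n) => // v Dv.
apply: (minorants_tail_le _ _ _ xh Dv).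
have /dual_cvgnP /(_ v) := xs n.
by under eq_fun do rewrite dual_sumE.
Qed.

(** The convexity defects [c k] of the terms are nonnegative, so their partial sums stay below their
    total; the difference is the defect of [gap n]. *)
Lemma convex_gap n : (forall k, convex_on D (h k)) -> convex_on D (gap n).
Proof.
move=> ch u v s t Du Dv s0 t0 st.
have [Dw _] := ch 0%N _ _ _ _ Du Dv s0 t0 st; split => //.
set w := s *: u + t *: v in Dw *.
pose c k : R := s * h k u + t * h k v - h k w.
have cl : series c @ \oo --> s * H u + t * H v - H w.
  have -> : c = s *: (h ^~ u) + t *: (h ^~ v) - h ^~ w by [].
  rewrite seriesD seriesN seriesD !seriesZ.
  by apply: cvgB; [apply: cvgD; apply: cvgZl_tmp|]; exact: hH.
have c0 k : 0 <= c k by rewrite subr_ge0; have [] := ch k _ _ _ _ Du Dv s0 t0 st.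
have : series c n <= s * H u + t * H v - H w.
  rewrite -(cvg_lim (@Rhausdorff R) cl); apply: nondecreasing_cvgn_le.
    by apply: nondecreasing_series => k _ _.
  exact: cvgP cl.
rewrite /gap /series/= /c sumrB big_split/= -!mulr_sumr; lra.
Qed.

(** Since [gap n = h n + gap n.+1], the sandwich theorem splits a functional below [gap n] into a
    minorant of [h n] and a remainder below [gap n.+1]; this is iterated from [y]. *)
Lemma minorants_decomposition (y : dual E) :
  (forall n, convex_on D (h n)) -> (forall n, h n 0 = 0) ->
  (forall n, {for 0, continuous (h n)}) -> H 0 = 0 ->
  (forall u, D u -> y u <= H u) ->
  exists2 x_, minorants x_ & series x_ @ \oo --> y.
Proof.
move=> ch h0 hc H0 yH.
have D00 : D 0 by exact: nbhs_singleton.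
have gap0 n : gap n 0 = 0.
  by rewrite /gap H0 /series/= big1 ?subrr// => k _; exact: h0.
have gapS n u : gap n u = h n u + gap n.+1 u.
  by rewrite /gap /series/= big_nat_recr//=; ring.
(* The domination hypothesis sits under the existential, with 0 as default value, so that [F] is
   total and the recursion carries no invariant. *)
have /choice[F FP] : forall p : nat * dual E, exists x' : dual E,
    (forall u, D u -> p.2 u <= gap p.1 u) ->
    (forall u, D u -> x' u <= h p.1 u) /\
    (forall u, D u -> (p.2 - x') u <= gap p.1.+1 u).
  move=> [n z] /=.
  have [zn|nzn] := pselect (forall u, D u -> z u <= gap n u); last by exists 0.
  have absD u : exists2 t : R, 0 < t & D (t *: u).
    by have [t /andP[t0 _] []] := nbhs0_absorbing _ u D0; exists t.
  have [|L [Lh Lgap]] := sandwich _ _ _ _ z (ch n) D00 (h0 n) absD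
    (convex_gap n.+1 ch) D00 (gap0 _).
    by move=> u Du _; rewrite -gapS; exact: zn.
  have [|x' x'E] := dual_of_le_continuous L _ (hc n) (h0 n); first exact: filterS D0.
  exists x' => _; split=> u Du; first by rewrite x'E; exact: Lh.
  by rewrite -[X in X <= _]/((z u : R) - x' u) x'E; exact: Lgap.
pose Y := fix Y n := if n is k.+1 then Y k - F (k, Y k) else y.
have Ygap n u : D u -> Y n u <= gap n u.
  elim: n u => [u Du|n IHn]; last by have [] := FP (n, Y n) IHn.
  by rewrite /gap /series/= big_geq// subr0; exact: yH.
exists (fun n => F (n, Y n)) => [n|].
  by have [] := FP (n, Y n) (Ygap n).
(* The sums telescope: [Y n] is what remains of [y] after [n] steps. *)
have -> : series (fun n => F (n, Y n)) = fun n => y - Y n.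
  apply/funext => n; rewrite /series/=; elim: n => [|n IHn].
    by rewrite big_geq// subrr.
  by rewrite big_nat_recr//= IHn opprB addrA [RHS]addrAC.
have Y0 : Y @ \oo --> (0 : dual E).
  move=> U /gap_small[n0 Un0]; exists n0 => // n /= n0n.
  exact: Un0 n0n (Ygap n).
apply/dual_cvgnP => u; rewrite -[X in _ --> X]subr0.
apply: cvgB; first exact: cvg_cst.
by have /dual_cvgnP /(_ u) := Y0.
Qed.

End subgradient_series.

(** * Subgradients as linear minorants of increments *)

Section subdifferential.
Context {R : realType} {E : tvsType R}.
Implicit Types g : E -> \bar R.

Lemma nbhs0_shift (x : E) (A : set E) :
  nbhs x A -> nbhs 0 [set u | A (x + u)].
Proof.
move=> /(nbhsB (- x)); rewrite addNr; apply: filterS => _ [v Av <-] /=.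
by rewrite addNKr.
Qed.

(** As [fine] sends infinite values to 0, this is the true increment only where [g] is finite;
    convexity and the subgradient criterion are therefore stated on a set [D] with [x + u] in the
    domain. *)
Definition increment g (x u : E) : R := fine (g (x + u)) - fine (g x).

Lemma increment0 g x : increment g x 0 = 0.
Proof. by rewrite /increment addr0 subrr. Qed.

Lemma increment_continuous g x : g x \is a fin_num -> {for x, continuous g} ->
  {for 0, continuous (increment g x)}.
Proof.
move=> gx cg.
have xu : (fun u => x + u) @ (0 : E) --> (x + 0 : E).
  by move=> A; rewrite /= addr0; exact: nbhs0_shift.
have cgf : fine \o g @ x --> fine (g x).
  by apply: fine_cvg; rewrite fineK.
apply: cvgB; last exact: cvg_cst.
rewrite addr0 in xu *; exact: cvg_comp xu cgf.
Qed.

Lemma proper_convex_fin_num g x : proper_convex g -> edom g x ->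
  g x \is a fin_num.
Proof. by move=> [gNy _ _] gx; rewrite fin_numE gNy lt_eqF. Qed.

Lemma edom_convex g x y (t : R) : convex_efun g -> edom g x -> edom g y ->
  0 <= t <= 1 -> edom g (t *: x + (1 - t) *: y).
Proof.
move=> cg gx gy /andP[t0 t1]; apply: le_lt_trans (cg _ _ _ _) _; first by rewrite t0.
have fin (s : R) z : 0 <= s -> edom g z -> (s%:E * g z < +oo)%E.
  rewrite /edom/= le_eqVlt => /predU1P[<- _|s0 gz]; first by rewrite mul0e ltry.
  move: gz; case: (g z) => [r _|//|_]; first by rewrite -EFinM ltry.
  by rewrite gt0_muleNy// ltNyr.
by apply: lte_add_pinfty; apply: fin => //; rewrite subr_ge0.
Qed.

Lemma increment_convex (D : set E) g x : proper_convex g ->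
  (forall u v (t : R), D u -> D v -> 0 <= t <= 1 -> D (t *: u + (1 - t) *: v)) ->
  D 0 -> (forall u, D u -> edom g (x + u)) -> convex_on D (increment g x).
Proof.
move=> pg cD D0 Dg u v s t Du Dv s0 t0 st.
have tE : t = 1 - s by rewrite -st addrAC subrr add0r.
have s01 : 0 <= s <= 1 by rewrite s0 -subr_ge0 -tE.
have Dw : D (s *: u + t *: v) by rewrite tE; exact: cD.
split => //; have fin w : D w -> g (x + w) \is a fin_num.
  by move=> Dw'; apply: proper_convex_fin_num => //; exact: Dg.
have [_ _ cg] := pg.
have := cg (x + u) (x + v) s s01; rewrite -tE.
have -> : s *: (x + u) + t *: (x + v) = x + (s *: u + t *: v).
  by rewrite !scalerDr addrACA -scalerDl st scale1r.
rewrite -(fineK (fin _ Dw)) -(fineK (fin _ Du)) -(fineK (fin _ Dv)).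
rewrite -!EFinM -EFinD lee_fin /increment; rewrite tE; lra.
Qed.

(** From local to global: for [y] in the domain, test the inequality at [t (y - x)] in [D], bound
    the increment there by [t (g y - g x)] using convexity, and divide by [t]. Outside the domain
    the right-hand side is infinite. *)
Lemma subdifferentialP (D : set E) g x (x' : dual E) : proper_convex g ->
  nbhs 0 D -> (forall u, D u -> edom g (x + u)) ->
  subdifferential g x x' <-> forall u, D u -> x' u <= increment g x u.
Proof.
move=> pg D0 Dg; have gxE : edom g x.
  by rewrite -[x]addr0; apply: Dg; exact: nbhs_singleton.
have gx := proper_convex_fin_num _ _ pg gxE.
split=> [[_ x'g] u Du|x'g].
  have gxu := proper_convex_fin_num _ _ pg (Dg _ Du).
  have := x'g (x + u); rewrite [x + u - x]addrC addKr.
  by rewrite -[in leRHS](fineK gx) -(fineK gxu) -EFinB lee_fin.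
split => // y; have [gNy _ cg] := pg.
have [gyE|/negP] := pselect (edom g y); last first.
  rewrite -leNgt leye_eq => /eqP ->.
  by rewrite -(fineK gx) -EFinN addye// leey.
have gy := proper_convex_fin_num _ _ pg gyE.
rewrite -(fineK gx) -(fineK gy) -EFinB lee_fin.
have [t /andP[t0 t1] [Dt _]] := nbhs0_absorbing _ (y - x) D0.
have := x'g _ Dt; rewrite linearZ/= -[_ *: x' _]/(t * x' (y - x)) /increment.
have := cg y x t; rewrite (ltW t0) t1 => /(_ isT).
have -> : t *: y + (1 - t) *: x = x + t *: (y - x).
  by rewrite scalerBl scale1r scalerBr addrC -addrA [- _ + _]addrC.
have gt := proper_convex_fin_num _ _ pg (Dg _ Dt).
rewrite -(fineK gx) -(fineK gy) -(fineK gt) -!EFinM -EFinD lee_fin/= => h1 h2.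
rewrite -(ler_pM2l t0); lra.
Qed.

(** The sandwich theorem with the zero functional and, as second function, zero on the singleton of
    0, where the compatibility condition reads [0 <= g 0]. *)
Lemma subgradient_exists (D : set E) (g : E -> R) : nbhs 0 D -> convex_on D g ->
  g 0 = 0 -> {for 0, continuous g} ->
  exists x' : dual E, forall u, D u -> x' u <= g u.
Proof.
move=> D0 cg g0 gc.
have absD u : exists2 t : R, 0 < t & D (t *: u).
  by have [t /andP[t0 _] []] := nbhs0_absorbing _ u D0; exists t.
have c0 : convex_on [set 0 : E] (cst 0 : E -> R).
  by move=> _ _ s t -> -> _ _ _; rewrite /= !scaler0 !mulr0 !addr0.
have [|L [Lg _]] := sandwich _ _ _ _ (0 : dual E) cg (nbhs_singleton D0) g0 absD c0
  erefl erefl.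
  by move=> u _ -> /=; rewrite g0 addr0.
have [|x' x'E] := dual_of_le_continuous L _ gc g0; first exact: filterS D0.
by exists x' => u Du; rewrite x'E; exact: Lg.
Qed.

End subdifferential.

(** * Normal convergence of the subdifferentials *)

(** In the absence of the value [-oo], one term [+oo] makes all later partial sums [+oo]. This
    places the domain of [f] inside that of each [f_ n]. *)
Lemma eseries_term_lty {R : realType} (a : nat -> \bar R) (l : \bar R) n :
  (forall k, a k != -oo%E) -> (\sum_(0 <= k < n) a k)%E @[n --> \oo] --> l ->
  (l < +oo)%E -> (a n < +oo)%E.
Proof.
move=> aNy al; rewrite !ltey; apply: contra => /eqP any.
suff ay : (\sum_(0 <= k < m) a k)%E @[m --> \oo] --> +oo%E.
  by rewrite -(cvg_lim (@ereal_hausdorff R) al) (cvg_lim (@ereal_hausdorff R) ay).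
apply: cvg_near_cst; near=> m.
have nm : (n < m)%N by near: m; exact: nbhs_infty_gt.
by apply/esum_eqyP => //; exists n; rewrite mem_index_iota nm.
Unshelve. all: by end_near. Qed.

Theorem theorem9 (R : realType) (E : tvsType R) (hE : hausdorff_space E)
  (f : E -> \bar R) (f_ : nat -> E -> \bar R)
  (hf : proper_convex f) (hf_ : forall n, proper_convex (f_ n))
  (hsum : forall x : E, (\sum_(0 <= k < n) f_ k x)%E @[n --> \oo] --> f x)
  (cf : forall z : E, (edom f)° z -> {for z, continuous f})
  (cf_ : forall (n : nat) (z : E), (edom f)° z -> {for z, continuous (f_ n)}) :
  forall x : E, (edom f)° x ->
    normally_cvg (fun n => subdifferential (f_ n) x) (subdifferential f x).
Proof.
move=> x xf.
(* The translated domain of [f] is a convex neighbourhood of 0 on which [f] and all the [f_ n] are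
   finite, so the real-valued results apply with one common set. *)
pose D := [set u | edom f (x + u)].
have D0 : nbhs 0 D by exact: nbhs0_shift.
have D00 := nbhs_singleton D0.
have Df_ n u : D u -> edom (f_ n) (x + u).
  by apply: eseries_term_lty (hsum _) => k; have [] := hf_ k.
have cD u v (t : R) : D u -> D v -> 0 <= t <= 1 -> D (t *: u + (1 - t) *: v).
  move=> Du Dv t01; rewrite /D/=.
  have -> : x + (t *: u + (1 - t) *: v) = t *: (x + u) + (1 - t) *: (x + v).
    by rewrite !scalerDr addrACA -scalerDl [t + _]addrC subrK scale1r.
  by apply: edom_convex => //; have [] := hf.
have finf_ n u : D u -> f_ n (x + u) \is a fin_num.
  by move=> Du; apply: proper_convex_fin_num (hf_ n) _; exact: Df_.
have finf u : D u -> f (x + u) \is a fin_num.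
  by move=> Du; exact: proper_convex_fin_num hf _.
have sum_fine u : D u ->
    series (fun k => fine (f_ k (x + u))) @ \oo --> fine (f (x + u)).
  move=> Du; have := hsum (x + u); rewrite -(fineK (finf _ Du)) => /fine_cvg.
  have -> // : fine \o (fun n => \sum_(0 <= k < n) f_ k (x + u)%R)%E =
      series (fun k => fine (f_ k (x + u))).
  apply/funext => n /=; under eq_bigr do rewrite -(fineK (finf_ _ _ Du)).
  by rewrite sumEFin.
have hH u : D u -> series (fun n => increment (f_ n) x u) @ \oo --> increment f x u.
  move=> Du; rewrite -[fun n => _]/((fun k => fine (f_ k (x + u))) - (fun k => fine (f_ k x))).
  rewrite seriesD seriesN; apply: cvgB; first exact: sum_fine.
  by have := sum_fine 0 D00; rewrite addr0.
have fx : f x \is a fin_num by rewrite -[x]addr0; exact: finf.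
have f_x n : f_ n x \is a fin_num by rewrite -[x]addr0; exact: finf_.
have cH := increment_continuous _ _ fx (cf _ xf).
have ch n := increment_continuous _ _ (f_x n) (cf_ n _ xf).
have convh n : convex_on D (increment (f_ n) x).
  by apply: increment_convex => //; exact: Df_.
have subf_ n := subdifferentialP D (f_ n) x _ (hf_ n) D0 (Df_ n).
have subf := subdifferentialP D f x _ hf D0 (fun u Du => Du).
have minorantsP x_ : (forall n, subdifferential (f_ n) x (x_ n)) ->
    minorants D (fun n => increment (f_ n) x) x_.
  by move=> xs n; exact/subf_.
split.
- split=> [n|].
    have [|x' x'P] := subgradient_exists D _ D0 (convh n) _ (ch n).
      exact: increment0.
    by exists x'; exact/subf_.
  have [|||x' x'P] := subgradient_exists D (increment f x) D0 => //.
  + exact: increment_convex.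
  + exact: increment0.
  + by exists x'; exact/subf.
- move=> x_ /minorantsP xm.
  have [s sH xs] := minorants_series D _ _ D0 hH x_ (increment0 _ _) cH xm.
  by exists s => //; exact/subf.
- move=> U U0.
  have [n0 n0P] := minorants_tail_small D _ _ D0 hH U (increment0 _ _) cH U0.
  by exists n0 => x_ /minorantsP; exact: n0P.
- move=> y /subf yH.
  have [x_ xm xy] := minorants_decomposition D _ _ D0 hH y convh
    (fun n => increment0 _ _) ch (increment0 _ _) yH.
  by exists x_ => // n; exact/subf_/xm.
Qed.
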